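(* Let $\mathfrak g$ be a $4$-dimensional unimodular almost-abelian Lie algebra equipped with a left-invariant almost-Hermitian structure $(g,J)$ with $J$ non-integrable, such that the Lee form $\theta$ is $D^g$-parallel and non-zero. Suppose that $(g,J)$ is a solution to the second-Chern--Einstein problem. Then $\mathfrak g$ is isomorphic to one of the following Lie algebras (given by the non-zero brackets of a basis $\{e_1,e_2,e_3,e_4\}$, up to skew-symmetry): (1) $\mathcal A_{3,6}\oplus\mathcal A_1$: $[e_1,e_3]=-e_2$, $[e_2,e_3]=e_1$; (2) $\mathcal A_{3,4}\oplus\mathcal A_1$: $[e_1,e_3]=e_1$, $[e_2,e_3]=-e_2$. Both Lie algebras admit compact quotients.
   Context: A Lie algebra $\mathfrak g$ is almost-abelian if it has a codimension-one abelian ideal. A left-invariant almost-Hermitian structure on $\mathfrak g$ is an inner product $g$ and a $g$-orthogonal endomorphism $J$ with $J^2=-\mathrm{Id}$ on $\mathfrak g$, viewed as a left-invariant structure on the simply connected Lie group $G$ with Lie algebra $\mathfrak g$; all differential-geometric objects below are those of $(G,g,J)$. ''Admits compact quotients'' means that the associated simply connected Lie group admits a lattice (cocompact discrete subgroup). $F(X,Y)=g(JX,Y)$; in dimension $4$ the Lee form $\theta$ is defined by $dF=\theta\wedge F$. $D^g$ is the Levi-Civita connection. Curvature convention: $R^\nabla_{X,Y}=\nabla_{[X,Y]}-[\nabla_X,\nabla_Y]$. The Chern connection $\nabla$ is the unique connection with $\nabla g=0$, $\nabla J=0$ and torsion $T$ satisfying $T(JX,JY)=-T(X,Y)$. With $\{\epsilon_i\}_{i=1}^4$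 a $J$-adapted $g$-orthonormal frame, the second Chern--Ricci form is $r(X,Y)=\frac12\sum_{i=1}^4 g(R^\nabla_{\epsilon_i,J\epsilon_i}X,Y)$ and $s^H=\sum_i r(\epsilon_i,J\epsilon_i)$. $(g,J)$ is a solution to the second-Chern--Einstein problem if $r=\frac{s^H}{4}F$. *)

(* Defs.v *)
From HB Require Import structures.
From mathcomp Require Import all_boot all_order all_algebra sesquilinear.
From mathcomp Require Import generic_quotient.
From mathcomp Require Import all_classical all_reals all_analysis.
From mathcomp Require Import ring.

Set Implicit Arguments.
Unset Strict Implicit.
Unset Printing Implicit Defensive.

Import Order.TTheory GRing.Theory Num.Theory.
Import numFieldNormedType.Exports.

Local Open Scope classical_set_scope.
Local Open Scope ring_scope.

Record lieAlgebra (R : realType) := LieAlgebra {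
  lie_sort :> vectType R;
  lie_br : {bilinear lie_sort -> lie_sort -> lie_sort};
  lie_alt : forall x, lie_br x x = 0;
  lie_jacobi : forall x y z,
    lie_br x (lie_br y z) + lie_br y (lie_br z x) + lie_br z (lie_br x y) = 0
}.

Notation "[ 'lie' x , y ]" := (lie_br _ x y)
  (at level 0, format "[ 'lie'  x ,  y ]") : ring_scope.

Definition lie_isomorphic (R : realType) (L L' : lieAlgebra R) : Prop :=
  exists2 f : {linear L -> L'}, bijective f &
    forall x y, f [lie x, y] = [lie f x, f y].

Definition almost_abelian (R : realType) (L : lieAlgebra R) : Prop :=
  exists h : {vspace L},
    [/\ (\dim h).+1 = \dim {: L},
        forall x y, y \in h -> [lie x, y] \in h
      & forall x y, x \in h -> y \in h -> [lie x, y] = 0].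

Definition lie_unimodular (R : realType) (L : lieAlgebra R) : Prop :=
  forall x : L,
    \tr (passmx.mxof (vbasis {: L}) (vbasis {: L}) (linfun (lie_br L x))) = 0.

Section Models.
Context {R : realType}.
Local Notation V := 'rV[R]_4.

(* 'e_0, ..., 'e_3 is the basis e_1, ..., e_4.  Each bracket is the bilinear
   extension of its non-zero values: [e_1, e_3] = - e_2, [e_2, e_3] = e_1 for
   A_{3,6} + A_1, and [e_1, e_3] = e_1, [e_2, e_3] = - e_2 for
   A_{3,4} + A_1. *)
Local Notation pl x y i j := (x 0 i * y 0 j - x 0 j * y 0 i).

Definition A36A1_br (x y : V) : V :=
  pl x y 0 2 *: (- 'e_1) + pl x y 1 2 *: 'e_0.

Definition A34A1_br (x y : V) : V :=
  pl x y 0 2 *: 'e_0 + pl x y 1 2 *: (- 'e_1).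

Lemma A36A1_br_bilinear : bilinear_for *:%R *:%R A36A1_br.
Proof.
by split=> y k x z; apply/rowP => i; rewrite /A36A1_br !mxE; ring.
Qed.

Lemma A34A1_br_bilinear : bilinear_for *:%R *:%R A34A1_br.
Proof.
by split=> y k x z; apply/rowP => i; rewrite /A34A1_br !mxE; ring.
Qed.

HB.instance Definition _ :=
  bilinear_isBilinear.Build R V V V *:%R *:%R A36A1_br A36A1_br_bilinear.
HB.instance Definition _ :=
  bilinear_isBilinear.Build R V V V *:%R *:%R A34A1_br A34A1_br_bilinear.

Lemma A36A1_alt x : A36A1_br x x = 0.
Proof. by apply/rowP => i; rewrite /A36A1_br !mxE; ring. Qed.

Lemma A34A1_alt x : A34A1_br x x = 0.
Proof. by apply/rowP => i; rewrite /A34A1_br !mxE; ring. Qed.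

Lemma A36A1_jacobi x y z :
  A36A1_br x (A36A1_br y z) + A36A1_br y (A36A1_br z x)
  + A36A1_br z (A36A1_br x y) = 0.
Proof. by apply/rowP => i; rewrite /A36A1_br !mxE /=; ring. Qed.

Lemma A34A1_jacobi x y z :
  A34A1_br x (A34A1_br y z) + A34A1_br y (A34A1_br z x)
  + A34A1_br z (A34A1_br x y) = 0.
Proof. by apply/rowP => i; rewrite /A34A1_br !mxE /=; ring. Qed.

End Models.

Definition A36A1 (R : realType) : lieAlgebra R :=
  @LieAlgebra R 'rV[R]_4 A36A1_br A36A1_alt A36A1_jacobi.

Definition A34A1 (R : realType) : lieAlgebra R :=
  @LieAlgebra R 'rV[R]_4 A34A1_br A34A1_alt A34A1_jacobi.

(* A left-invariant tensor field on G is identified with its value on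
   left-invariant vector fields, i.e. with a tensor on the Lie algebra; a
   left-invariant connection N is identified with the bilinear map
   (x, y) |-> N_x y on left-invariant fields.  Functions of the form g(x, y)
   are then constant, so that the terms differentiating them vanish. *)

Record almostHermitian (R : realType) (L : lieAlgebra R) := AlmostHermitian {
  ah_g : {dot L for idfun};
  ah_J : {linear L -> L};
  ah_JJ : forall x, ah_J (ah_J x) = - x;
  ah_gJ : forall x y, ah_g (ah_J x) (ah_J y) = ah_g x y
}.

Section AlmostHermitian.
Context {R : realType} {L : lieAlgebra R}.
Variable h : almostHermitian L.
Local Notation g := (ah_g h).
Local Notation J := (ah_J h).

Definition nijenhuis (x y : L) : L :=
  [lie J x, J y] - J [lie J x, y] - J [lie x, J y] - [lie x, y].

(* Newlander-Nirenberg: J comes from complex coordinates iff nijenhuis = 0. *)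
Definition integrable_J : Prop := forall x y, nijenhuis x y = 0.

Definition fundamental_form (x y : L) : R := g (J x) y.

(* The exterior derivative of a left-invariant 2-form. *)
Definition d2form (w : L -> L -> R) (x y z : L) : R :=
  - w [lie x, y] z - w [lie y, z] x - w [lie z, x] y.

Definition wedge12 (t : L -> R) (w : L -> L -> R) (x y z : L) : R :=
  t x * w y z + t y * w z x + t z * w x y.

Definition lee_form (t : {scalar L}) : Prop :=
  forall x y z,
    d2form fundamental_form x y z = wedge12 t fundamental_form x y z.

Definition torsion (N : {bilinear L -> L -> L}) (x y : L) : L :=
  N x y - N y x - [lie x, y].

Definition metric_connection (N : {bilinear L -> L -> L}) : Prop :=
  forall x y z, g (N x y) z + g y (N x z) = 0.

Definition levi_civita (D : {bilinear L -> L -> L}) : Prop :=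
  metric_connection D /\ forall x y, torsion D x y = 0.

(* - t (D x y) is (D_x t)(y), since t(y) is constant on G. *)
Definition parallel_form (D : {bilinear L -> L -> L}) (t : {scalar L}) :
    Prop :=
  forall x y, - t (D x y) = 0.

Definition chern_connection (N : {bilinear L -> L -> L}) : Prop :=
  [/\ metric_connection N,
      forall x y, N x (J y) = J (N x y)
    & forall x y, torsion N (J x) (J y) = - torsion N x y].

Definition curvature (N : {bilinear L -> L -> L}) (x y z : L) : L :=
  N [lie x, y] z - (N x (N y z) - N y (N x z)).

(* The frame is (e_0, J e_0, e_2, J e_2); second_chern_ricci does not depend on
   its choice. *)
Definition adapted_frame (e : 'I_4 -> L) : Prop :=
  [/\ forall i j, g (e i) (e j) = (i == j)%:R,
      e 1 = J (e 0) & e 3 = J (e 2)].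

Definition second_chern_ricci (N : {bilinear L -> L -> L}) (e : 'I_4 -> L)
    (x y : L) : R :=
  2^-1 * \sum_(i < 4) g (curvature N (e i) (J (e i)) x) y.

Definition hermitian_scalar_curvature (N : {bilinear L -> L -> L})
    (e : 'I_4 -> L) : R :=
  \sum_(i < 4) second_chern_ricci N e (e i) (J (e i)).

Definition second_chern_einstein (N : {bilinear L -> L -> L})
    (e : 'I_4 -> L) : Prop :=
  forall x y, second_chern_ricci N e x y =
    hermitian_scalar_curvature N e / 4 * fundamental_form x y.

End AlmostHermitian.

HB.mixin Record isTopologicalGroup G of Topological G & Group G := {
  tmulg_continuous : continuous (fun p : G * G => (p.1 * p.2)%g);
  tinvg_continuous : continuous (fun x : G => (x^-1)%g)
}.

#[short(type="topologicalGroupType")]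
HB.structure Definition TopologicalGroup :=
  {G of Topological G & Group G & isTopologicalGroup G}.

(* On an open U of a finite-dimensional V this is C^k: all iterated directional
   derivatives up to order k exist and are continuous on U.  'D_v f at a point
   of U only depends on f near that point, so junk values outside U are
   harmless. *)
Fixpoint Ck_on (R : realType) (V W : normedModType R) (k : nat) (U : set V)
    (f : V -> W) : Prop :=
  (forall x, U x -> {for x, continuous f}) /\
  (if k is k'.+1 then
     forall v, (forall x, U x -> derivable f x v) /\ Ck_on k' U ('D_v f)
   else True).

Definition smooth_on (R : realType) (V W : normedModType R) (U : set V)
    (f : V -> W) : Prop :=
  forall k, Ck_on k U f.

(* chart_map and chart_inv are total functions that only matter on chart_dom
   and chart_cod. *)
Record chart (R : realType) (n : nat) (M : topologicalType) := Chart {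
  chart_dom : set M;
  chart_cod : set 'rV[R]_n;
  chart_map :> M -> 'rV[R]_n;
  chart_inv : 'rV[R]_n -> M;
  chart_dom_open : open chart_dom;
  chart_cod_open : open chart_cod;
  chart_map_cod : forall x, chart_dom x -> chart_cod (chart_map x);
  chart_inv_dom : forall a, chart_cod a -> chart_dom (chart_inv a);
  chart_mapK : forall x, chart_dom x -> chart_inv (chart_map x) = x;
  chart_invK : forall a, chart_cod a -> chart_map (chart_inv a) = a;
  chart_map_cts : {within chart_dom, continuous chart_map};
  chart_inv_cts : {within chart_cod, continuous chart_inv}
}.

Record lieGroup (R : realType) (n : nat) := LieGroup {
  lg_sort :> topologicalGroupType;
  lg_hausdorff : hausdorff_space lg_sort;
  lg_second_countable : @second_countable lg_sort;
  lg_atlas : set (chart R n lg_sort);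
  lg_cover : forall x : lg_sort, exists2 c, lg_atlas c & chart_dom c x;
  lg_compatible : forall c d, lg_atlas c -> lg_atlas d ->
    smooth_on (chart_cod c `&` chart_inv c @^-1` chart_dom d)
      (d \o chart_inv c);
  lg_mul_smooth : forall c c' d, lg_atlas c -> lg_atlas c' -> lg_atlas d ->
    smooth_on
      [set p : 'rV[R]_n * 'rV[R]_n |
        [/\ chart_cod c p.1, chart_cod c' p.2
          & chart_dom d (chart_inv c p.1 * chart_inv c' p.2)%g]]
      (fun p => d (chart_inv c p.1 * chart_inv c' p.2)%g);
  lg_inv_smooth : forall c d, lg_atlas c -> lg_atlas d ->
    smooth_on
      [set a | chart_cod c a /\ chart_dom d (chart_inv c a)^-1%g]
      (fun a => d (chart_inv c a)^-1%g)
}.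

Definition vf_bracket (R : realType) (n : nat)
    (X Y : 'rV[R]_n -> 'rV[R]_n) (a : 'rV[R]_n) : 'rV[R]_n :=
  'D_(X a) Y a - 'D_(Y a) X a.

Section LieAlgebraOfLieGroup.
Context {R : realType} {n : nat}.
Variables (G : lieGroup R n) (c : chart R n G).

(* In the chart c around 1, the left-invariant vector field whose value at 1
   is v: its value at the point a is the differential of the left translation
   by c^-1(a), applied to v. *)
Definition left_invariant_vf (v a : 'rV[R]_n) : 'rV[R]_n :=
  'D_v (fun b => c (chart_inv c a * chart_inv c b)%g) (c 1%g).

Definition tangent_bracket (v w : 'rV[R]_n) : 'rV[R]_n :=
  vf_bracket (left_invariant_vf v) (left_invariant_vf w) (c 1%g).

End LieAlgebraOfLieGroup.

(* The tangent space at 1 is identified with 'rV_n through the chart c. *)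
Definition is_lie_algebra_of (R : realType) (n : nat) (G : lieGroup R n)
    (L : lieAlgebra R) : Prop :=
  exists c : chart R n G, [/\ lg_atlas c, chart_dom c 1%g &
    exists2 f : {linear L -> 'rV[R]_n}, bijective f &
      forall x y, f [lie x, y] = tangent_bracket c (f x) (f y)].

Definition simply_connected (R : realType) (M : topologicalType) : Prop :=
  (forall x y : M, exists2 p : R -> M,
     {within `[0, 1], continuous p} & p 0 = x /\ p 1 = y) /\
  (forall p : R -> M, {within `[0, 1], continuous p} -> p 0 = p 1 ->
     exists2 H : R * R -> M,
       {within `[0, 1] `*` `[0, 1], continuous H} &
       forall t, 0 <= t <= 1 ->
         [/\ H (0, t) = p t, H (1, t) = p 0,
             H (t, 0) = p 0 & H (t, 1) = p 0]).

Record subgroup (G : groupType) := Subgroup {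
  sg_set : set G;
  sg_1 : sg_set 1%g;
  sg_M : forall x y, sg_set x -> sg_set y -> sg_set (x * y)%g;
  sg_V : forall x, sg_set x -> sg_set (x^-1)%g
}.

Section Cosets.
Context {G : groupType}.
Variable S : subgroup G.

(* x S = y S *)
Definition coset_eq : rel G := fun x y => `[< sg_set S (x^-1 * y)%g >].

Lemma coset_eq_refl : reflexive coset_eq.
Proof. by move=> x; apply/asboolP; rewrite mulVg; exact: sg_1. Qed.

Lemma coset_eq_sym : symmetric coset_eq.
Proof.
have H x y : coset_eq x y -> coset_eq y x.
  by move=> /asboolP /sg_V; rewrite invgM invgK => ?; apply/asboolP.
by move=> x y; apply/idP/idP; exact: H.
Qed.

Lemma coset_eq_trans : transitive coset_eq.
Proof.
move=> y x z /asboolP xy /asboolP yz; apply/asboolP.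
by have := sg_M xy yz; rewrite mulgA -(mulgA x^-1%g) mulgV mulg1.
Qed.

Canonical coset_equiv := EquivRel coset_eq
  coset_eq_refl coset_eq_sym coset_eq_trans.

End Cosets.

Definition lattice (G : topologicalGroupType) (S : subgroup G) : Prop :=
  (forall x : G, sg_set S x -> isolated (sg_set S) x) /\
  compact [set: quotient_topology {eq_quot (coset_equiv S)}%qT].

(* The simply connected Lie group with Lie algebra L is unique up to
   isomorphism, hence the existential quantifier on G. *)
Definition admits_compact_quotients (R : realType) (L : lieAlgebra R) : Prop :=
  exists n (G : lieGroup R n),
    [/\ simply_connected R G, is_lie_algebra_of G L
      & exists S : subgroup G, lattice S].

(* Main.v *)
(* Let n span the orthogonal of the abelian ideal and let w be the vector dual
   to the Lee form.  A parallel w is Killing and orthogonal to [L, L]; comparing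
   with dF = theta /\ F this puts w in the orthogonal of n and J n and makes it
   central.  In the orthogonal basis n, J n, w, J w the only brackets left are
   [n, J n] = |n|^2 J w and [n, J w] = b J n, where unimodularity removes the
   J n-component of the former.  J is integrable iff b = 0, and the sign of b
   selects the model.

   For the compact quotients, both simply connected groups are written as R^4
   with the product x * y = x + y Q(x_3), where Q is a one-parameter group of
   matrices.  The basis of R^4 and the time scale are chosen such that Q(1) and
   Q(-1) have integer entries, so that Z^4 is a subgroup. *)

From HB Require Import structures.
Require Import Defs.
From mathcomp Require Import all_boot all_order all_algebra sesquilinear.
From mathcomp Require Import generic_quotient.
From mathcomp Require Import all_classical all_reals all_analysis.
From mathcomp Require Import ring lra.

Set Implicit Arguments.
Unset Strict Implicit.
Unset Printing Implicit Defensive.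

Import Order.TTheory GRing.Theory Num.Theory.
Import numFieldNormedType.Exports.

Local Open Scope classical_set_scope.
Local Open Scope ring_scope.

(** * Smooth functions *)

Lemma continuous_mx (R : realType) (T : topologicalType) m n
    (M : T -> 'M[R]_(m, n)) x :
  (forall i j, {for x, continuous (fun t => M t i j)}) ->
  {for x, continuous M}.
Proof.
move=> cM; apply/cvgrPdist_lt => e e0; near=> t.
rewrite [ltLHS]/Num.Def.normr/= mx_normrE.
apply/bigmax_ltP; split=> // -[i j] _; rewrite !mxE/=.
move: i j; near: t; apply: filter_forall => i; apply: filter_forall => j.
by move/cvgrPdist_lt : (cM i j); exact.
Unshelve. all: by end_near. Qed.

Section CkCalculus.
Context {R : realType} {V : normedModType R}.
Implicit Types f g : V -> R.

Lemma Ck_onW (W : normedModType R) k U (f : V -> W) :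
  Ck_on k.+1 U f -> Ck_on k U f.
Proof.
elim: k f => [|k IH] f; first by case.
move=> [cf df]; split => // v; split; first by case: (df v).
by apply: IH; case: (df v).
Qed.

Lemma Ck_on_cst (W : normedModType R) (w : W) k U : Ck_on k U (cst w : V -> W).
Proof.
elim: k w => [|k IH] w /=; split => //; try by move=> x _; exact: cvg_cst.
move=> v; split => [x _|]; first exact: derivable_cst.
have -> : 'D_v (cst w : V -> W) = cst 0.
  by apply/funext => x; rewrite derive_cst.
exact: IH.
Qed.

Lemma Ck_onD (W : normedModType R) k (f g : V -> W) :
  Ck_on k setT f -> Ck_on k setT g -> Ck_on k setT (f \+ g).
Proof.
elim: k f g => [|k IH] f g [cf df] [cg dg]; split=> //.
- by move=> x _; apply: continuousD; [exact: cf|exact: cg].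
- by move=> x _; apply: continuousD; [exact: cf|exact: cg].
move=> v; have [[df1 df2] [dg1 dg2]] := (df v, dg v).
split=> [x _|]; first by apply: derivableD; [exact: df1|exact: dg1].
have -> : 'D_v (f \+ g) = 'D_v f \+ 'D_v g.
  by apply/funext => x; rewrite deriveD//; [exact: df1|exact: dg1].
exact: IH.
Qed.

(** The Leibniz rule pairs an undifferentiated factor with a differentiated one, so the induction
    also lowers the order of [f] and [g] by [Ck_onW]. *)
Lemma Ck_onM k f g :
  Ck_on k setT f -> Ck_on k setT g -> Ck_on k setT (f \* g).
Proof.
elim: k f g => [|k IH] f g Cf Cg; have [cf df] := Cf;
  have [cg dg] := Cg; split=> //.
- by move=> x _; apply: continuousM; [exact: cf|exact: cg].
- by move=> x _; apply: continuousM; [exact: cf|exact: cg].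
move=> v; have [[df1 df2] [dg1 dg2]] := (df v, dg v).
split=> [x _|]; first by apply: derivableM; [exact: df1|exact: dg1].
have -> : 'D_v (f \* g) = (f \* 'D_v g) \+ (g \* 'D_v f).
  by apply/funext => x; rewrite deriveM//; [exact: df1|exact: dg1].
by apply: Ck_onD; apply: IH => //; exact: Ck_onW.
Qed.

Lemma Ck_on_sum (I : Type) (r : seq I) (F : I -> V -> R) k :
  (forall i, Ck_on k setT (F i)) -> Ck_on k setT (fun x => \sum_(i <- r) F i x).
Proof.
move=> CF; elim: r => [|i r IH].
  rewrite (_ : (fun _ => _) = cst 0); first exact: Ck_on_cst.
  by apply/funext => x; rewrite big_nil.
rewrite (_ : (fun _ => _) = F i \+ (fun x => \sum_(i <- r) F i x)).
  exact: Ck_onD.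
by apply/funext => x; rewrite big_cons.
Qed.

Lemma Ck_on_linear (l : {linear V -> R}) k : continuous l -> Ck_on k setT l.
Proof.
move=> cl.
have dl x v : derivable l x v.
  by apply: diff_derivable; exact: linear_differentiable.
case: k => [|k]; split => //; first by move=> x _; exact: cl.
  by move=> x _; exact: cl.
move=> v; split => [x _|]; first exact: dl.
rewrite (_ : 'D_v l = cst (l v)); first exact: Ck_on_cst.
by apply/funext => x; rewrite deriveE ?diff_lin//; exact: linear_differentiable.
Qed.

Lemma Ck_on_mx m n (M : V -> 'M[R]_(m, n)) k :
  (forall i j, Ck_on k setT (fun x => M x i j)) -> Ck_on k setT M.
Proof.
elim: k M => [|k IH] M CM.
  split=> // x _; apply: continuous_mx => i j.
  by have [] := CM i j => /(_ x I).
split.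
  by move=> x _; apply: continuous_mx => i j; have [] := CM i j => /(_ x I).
move=> v; have dM x : derivable M x v.
  by apply/derivable_mxP => i j; have [_ /(_ v)[]] := CM i j => /(_ x I).
split=> // ; apply: IH => i j.
rewrite (_ : (fun _ => _) = 'D_v (fun t => M t i j)).
  by have [_ /(_ v)[]] := CM i j.
by apply/funext => x; rewrite derive_mx// mxE.
Qed.

Lemma is_derive_comp_linear (f : R -> R) (l : {linear V -> R}) x v d :
  continuous l -> is_derive (l x) (1 : R) f d ->
  is_derive x v (fun x => f (l x)) (l v * d).
Proof.
move=> cl [df dfE].
have dlx : differentiable l x by exact: linear_differentiable.
have dfl : differentiable f (l x) by exact/derivable1_diffP.
apply: DeriveDef; first exact/diff_derivable/(@differentiable_comp _ _ _ _ l f).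
rewrite deriveE; last exact: (@differentiable_comp _ _ _ _ l f).
by rewrite (@diff_comp _ _ _ _ l f)//= diff_lin// diff1E// derive1E dfE.
Qed.

(** The equation Q' = Q B makes each directional derivative of an entry a constant combination of
    entries of the same row, so induction on the order closes without any assumption on higher
    derivatives. *)
Lemma Ck_on_flow n (Q : R -> 'M[R]_n) (B : 'M[R]_n) (l : {linear V -> R}) k :
  (forall z i j, is_derive z (1 : R) (fun t => Q t i j) ((Q z *m B) i j)) ->
  continuous l -> forall i j, Ck_on k setT (fun x => Q (l x) i j).
Proof.
move=> dQ cl.
have cQl x i j : {for x, continuous (fun x => Q (l x) i j)}.
  apply: differentiable_continuous.
  apply: (@differentiable_comp _ _ _ _ l (fun t => Q t i j)).
    exact: linear_differentiable.
  by apply/derivable1_diffP; have [] := dQ (l x) i j.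
elim: k => [|k IH] i j; split => // v; split.
  by move=> x _; have [] := is_derive_comp_linear v cl (dQ (l x) i j).
rewrite (_ : 'D_v _ =
    fun x => \sum_m (cst (l v * B m j) \* (fun x => Q (l x) i m)) x).
  by apply: Ck_on_sum => m; apply: Ck_onM; [exact: Ck_on_cst|exact: IH].
apply/funext => x.
rewrite (@derive_val _ _ _ _ _ _ _ (is_derive_comp_linear v cl (dQ (l x) i j))).
by rewrite mxE mulr_sumr; apply: eq_bigr => m _ /=; ring.
Qed.

End CkCalculus.

Lemma is_derive_comp_scale (R : realType) (f : R -> R) (w s d : R) :
  is_derive (w * s) (1 : R) f d ->
  is_derive s (1 : R) (fun t => f (w * t)) (w * d).
Proof.
move=> df; rewrite -[w in w * d]mulr1.
apply: (@is_derive_comp_linear R R^o f ( *:%R w) s 1 d) df.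
exact: (@scaler_continuous R R^o).
Qed.

(** * Topology of the space of row vectors *)

Section RowSpace.
Context {R : realType}.

Definition rcoord n (i : 'I_n) (x : 'rV[R]_n) : R := x 0 i.

Lemma rcoord_linear n i : linear (@rcoord n i).
Proof. by move=> a x y; rewrite /rcoord !mxE. Qed.

HB.instance Definition _ n i :=
  GRing.isLinear.Build R 'rV[R]_n R _ (@rcoord n i) (@rcoord_linear n i).

Lemma continuous_rcoord n i : continuous (@rcoord n i).
Proof. exact: coord_continuous. Qed.

Lemma continuous_mulmxr m n (M : 'M[R]_(m, n)) :
  continuous (fun x : 'rV[R]_m => x *m M).
Proof.
move=> x; apply: continuous_mx => i j; rewrite ord1.
rewrite (_ : (fun _ => _) =
    fun x => \sum_a (rcoord a \* (cst (M a j) : 'rV[R]_m -> R)) x); last first.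
  by apply/funext => y; rewrite mxE.
have [] : Ck_on 0 setT
    (fun x => \sum_a (rcoord a \* (cst (M a j) : 'rV[R]_m -> R)) x).
  apply: Ck_on_sum => a; apply: Ck_onM; last exact: Ck_on_cst.
  by apply: Ck_on_linear; exact: continuous_rcoord.
by move=> /(_ x I).
Qed.

(** The base consists of the balls of radius 1/(k+1) around rational points. With 1/(k+1) < e/2 and
    a rational q that close to x, the ball around q contains x and stays inside the ball of radius e
    around x. *)
Lemma second_countable_rV n : @second_countable 'rV[R]_n.
Proof.
pose f (p : 'rV[rat]_n * nat) : set 'rV[R]_n :=
  ball (map_mx ratr p.1 : 'rV[R]_n) p.2.+1%:R^-1.
exists (range f).
  exact: (sub_countable (card_image_le _ _) (countableP _)).
split; first by move=> _ [[q k] _ <-]; apply: ball_open; rewrite /= invr_gt0.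
move=> x U /nbhs_ballP[e /= e0 eU].
have [k ke] : exists k, k.+1%:R^-1 < e / 2 :> R.
  have [k] := ltr_add_invr (divr_gt0 e0 (ltr0n _ 2)).
  by rewrite add0r; exists k.
have q_ i : {q : rat | `|x 0 i - ratr q| < k.+1%:R^-1}.
  apply: cid.
  have k0 : 0 < k.+1%:R^-1 :> R by [].
  have [|q] := @rat_in_itvoo R (x 0 i - k.+1%:R^-1) (x 0 i + k.+1%:R^-1).
    by rewrite ltrD2l gtrN.
  rewrite in_itv/= => /andP[q1 q2]; exists q.
  by move: (_^-1) q1 q2 => d q1 q2; rewrite ltr_norml; apply/andP; split; lra.
pose q := \row_i sval (q_ i).
have fx : f (q, k) x.
  rewrite /f/= -ball_normE/=.
  rewrite [ltLHS]/Num.Def.normr/= mx_normrE.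
  apply/bigmax_ltP; split=> [|[a i] _]; first by rewrite invr_gt0.
  rewrite !mxE ord1 distrC/=; exact: svalP (q_ i).
exists (f (q, k)) => //; first by split => //; exists (q, k).
move=> y fy; apply: eU; rewrite [e]splitr.
apply: (@ball_triangle _ _ (map_mx ratr q : 'rV[R]_n)).
  by apply/ball_sym; apply: le_ball fx; exact: ltW.
by apply: le_ball fy; exact: ltW.
Qed.

End RowSpace.

(** * Semidirect products with a one-parameter matrix group *)

Section Semidirect.
Context {R : realType} {n : nat}.

(* flow_timeE says that flow_mx fixes the time coordinate, which makes
   x + y Q(time x) associative. *)
Record flow := Flow {
  flow_mx :> R -> 'M[R]_n;
  flow_gen : 'M[R]_n;
  flow_time : 'I_n;
  flow_mx0 : flow_mx 0 = 1%:M;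
  flow_mxD : forall s t, flow_mx (s + t) = flow_mx s *m flow_mx t;
  is_derive_flow : forall s i j, is_derive s (1 : R)
    (fun t => flow_mx t i j) ((flow_mx s *m flow_gen) i j);
  flow_timeE : forall (x : 'rV[R]_n) s,
    (x *m flow_mx s) 0 flow_time = x 0 flow_time
}.

(** An alias indexed by [Q], so that each flow puts its own group law on the same topological
    space. *)
Definition semidirect (Q : flow) : Type := 'rV[R]_n.

Variable Q : flow.
Local Notation G := (semidirect Q).
Local Notation tm x := ((x : 'rV[R]_n) 0 (flow_time Q)).

HB.instance Definition _ := Choice.copy G 'rV[R]_n.
HB.instance Definition _ := Topological.copy G 'rV[R]_n.

Definition sd_mul (x y : G) : G := (x : 'rV_n) + (y : 'rV_n) *m Q (tm x).
Definition sd_inv (x : G) : G := - (x : 'rV_n) *m Q (- tm x).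

Lemma flowVK s : Q (- s) *m Q s = 1%:M.
Proof. by rewrite -flow_mxD addNr flow_mx0. Qed.

Lemma sd_time_mul x y : tm (sd_mul x y) = tm x + tm y.
Proof. by rewrite /sd_mul mxE flow_timeE. Qed.

Lemma sd_mulA : associative sd_mul.
Proof.
move=> x y z; rewrite {1 3}/sd_mul sd_time_mul /sd_mul mulmxDl -mulmxA addrA.
(* Matrices act on rows from the right, so z meets the flow at time y before that at time x;
   addition of times commutes. *)
by rewrite [tm x + _]addrC flow_mxD.
Qed.

Lemma sd_mul1g : left_id (0 : 'rV_n) sd_mul.
Proof. by move=> x; rewrite /sd_mul mxE flow_mx0 mulmx1 add0r. Qed.

Lemma sd_mulg1 : right_id (0 : 'rV_n) sd_mul.
Proof. by move=> x; rewrite /sd_mul mul0mx addr0. Qed.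

Lemma sd_mulVg : left_inverse (0 : 'rV_n) sd_inv sd_mul.
Proof.
move=> x; rewrite /sd_mul {2}/sd_inv flow_timeE mxE.
by rewrite /sd_inv mulNmx addNr.
Qed.

Lemma sd_mulgV : right_inverse (0 : 'rV_n) sd_inv sd_mul.
Proof.
by move=> x; rewrite /sd_mul /sd_inv -mulmxA flowVK mulmx1 subrr.
Qed.

HB.instance Definition _ :=
  isGroup.Build G sd_mulA sd_mul1g sd_mulg1 sd_mulVg sd_mulgV.

(** Each coordinate of a product is a sum of products of linear coordinates and flow entries at a
    linear time. *)
Lemma sd_mul_smooth : smooth_on setT
  (fun p : 'rV[R]_n * 'rV[R]_n => sd_mul p.1 p.2 : 'rV[R]_n).
Proof.
move=> k; apply: Ck_on_mx => i j; rewrite ord1.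
have cfst (m : 'I_n) : continuous (rcoord m \o (@fst 'rV[R]_n 'rV[R]_n)).
  move=> x; apply: continuous_comp; first exact: cvg_fst.
  exact: continuous_rcoord.
have csnd (m : 'I_n) : continuous (rcoord m \o (@snd 'rV[R]_n 'rV[R]_n)).
  move=> x; apply: continuous_comp; first exact: cvg_snd.
  exact: continuous_rcoord.
rewrite (_ : (fun _ => _) =
  (rcoord j \o fst) \+ (fun p => \sum_m ((rcoord m \o snd) \*
    (fun p => Q (rcoord (flow_time Q) p.1) m j)) p)).
  apply: Ck_onD; first by apply: Ck_on_linear; exact: cfst.
  apply: Ck_on_sum => m; apply: Ck_onM.
    by apply: Ck_on_linear; exact: csnd.
  exact: (Ck_on_flow _ (is_derive_flow Q) (cfst (flow_time Q))).
by apply/funext => p; rewrite /sd_mul !mxE.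
Qed.

Lemma sd_inv_smooth : smooth_on setT (fun x : 'rV[R]_n => sd_inv x : 'rV[R]_n).
Proof.
move=> k; apply: Ck_on_mx => i j; rewrite ord1.
have cN (m : 'I_n) : continuous (rcoord m \o (@GRing.opp 'rV[R]_n)).
  move=> x; apply: continuous_comp; [exact: opp_continuous|].
  exact: continuous_rcoord.
rewrite (_ : (fun _ => _) =
  (fun p => \sum_m ((rcoord m \o -%R) \*
    (fun p => Q (rcoord (flow_time Q) (- p)) m j)) p)).
  apply: Ck_on_sum => m; apply: Ck_onM; first by apply: Ck_on_linear; exact: cN.
  exact: (Ck_on_flow _ (is_derive_flow Q) (cN (flow_time Q))).
apply/funext => p; rewrite /sd_inv !mxE; apply: eq_bigr => m _.
by rewrite /rcoord/= !mxE.
Qed.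

Lemma sd_mul_continuous : continuous (fun p : G * G => (p.1 * p.2)%g).
Proof. by move=> p; have [/(_ p I)] := sd_mul_smooth 0. Qed.

Lemma sd_inv_continuous : continuous (fun x : G => x^-1%g).
Proof. by move=> p; have [/(_ p I)] := sd_inv_smooth 0. Qed.

HB.instance Definition _ :=
  isTopologicalGroup.Build G sd_mul_continuous sd_inv_continuous.

End Semidirect.
Arguments flow : clear implicits.

(** * The Lie group of a flow and its Lie algebra *)

Lemma Ck_on_subset (R : realType) (V W : normedModType R) k (U : set V)
    (f : V -> W) :
  Ck_on k setT f -> Ck_on k U f.
Proof.
elim: k f => [|k IH] f [cf df]; split => //.
- by move=> x _; exact: cf.
- by move=> x _; exact: cf.
- by move=> v; have [df1 df2] := df v; split=> [x _|]; [exact: df1|exact: IH].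
Qed.

Section LieGroup.
Context {R : realType} {n : nat}.
Variable Q : flow R n.
Local Notation G := (semidirect Q).
Local Notation tm x := ((x : 'rV[R]_n) 0 (flow_time Q)).

Definition sd_chart : chart R n G :=
  @Chart R n G setT setT id id openT openT (fun _ _ => I) (fun _ _ => I)
    (fun _ _ => erefl) (fun _ _ => erefl)
    (continuous_subspaceT (fun x => @cvg_id _ _))
    (continuous_subspaceT (fun x => @cvg_id _ _)).

Lemma sd_cover (x : G) : exists2 c, [set sd_chart] c & chart_dom c x.
Proof. by exists sd_chart. Qed.

(** The only transition map is the identity, whose entries are linear forms. *)
Lemma sd_compatible c d : [set sd_chart] c -> [set sd_chart] d ->
  smooth_on (chart_cod c `&` chart_inv c @^-1` chart_dom d)
    (d \o chart_inv c).
Proof.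
move=> -> -> k; apply: Ck_on_subset; apply: Ck_on_mx => i j.
have @l : {linear 'rV[R]_n -> R}.
  by exists (fun N : 'rV[R]_n => N i j); do 2![eexists]; do ?[constructor];
     rewrite ?mxE// => ? *; rewrite ?mxE//; move=> ?; rewrite !mxE.
apply: (@Ck_on_linear _ _ l); exact: coord_continuous.
Qed.

Lemma sd_lie_mul_smooth c c' d :
  [set sd_chart] c -> [set sd_chart] c' -> [set sd_chart] d ->
  smooth_on
    [set p : 'rV[R]_n * 'rV[R]_n |
      [/\ chart_cod c p.1, chart_cod c' p.2
        & chart_dom d (chart_inv c p.1 * chart_inv c' p.2)%g]]
    (fun p => d (chart_inv c p.1 * chart_inv c' p.2)%g).
Proof.
by move=> -> -> -> k; apply: Ck_on_subset; exact: sd_mul_smooth.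
Qed.

Lemma sd_lie_inv_smooth c d : [set sd_chart] c -> [set sd_chart] d ->
  smooth_on
    [set a | chart_cod c a /\ chart_dom d (chart_inv c a)^-1%g]
    (fun a => d (chart_inv c a)^-1%g).
Proof. by move=> -> -> k; apply: Ck_on_subset; exact: sd_inv_smooth. Qed.

Lemma sd_hausdorff : hausdorff_space G.
Proof. exact: (@norm_hausdorff _ 'rV[R]_n). Qed.

Definition sd_lieGroup : lieGroup R n :=
  @LieGroup R n G sd_hausdorff (@second_countable_rV R n) [set sd_chart]
    sd_cover sd_compatible sd_lie_mul_smooth sd_lie_inv_smooth.

(** Segments join points, and shrinking linearly towards the base point [p 0] contracts a loop. *)
Lemma simply_connected_rV m : simply_connected R 'rV[R]_m.
Proof.
split=> [x y|p cp p01].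
  exists (fun t : R => x + t *: (y - x)); last first.
    by rewrite scale0r scale1r addr0 addrC subrK.
  apply: continuous_subspaceT => t.
  by apply: cvgD; [exact: cvg_cst|apply: cvgZr_tmp; exact: cvg_id].
exists (fun z : R * R => p 0 + (1 - z.1) *: (p z.2 - p 0)).
  apply/subspace_continuousP => -[s t] [/= s01 t01].
  apply: cvgD; first exact: cvg_cst.
  apply: cvgZ.
    apply: cvgB; first exact: cvg_cst.
    move=> A sA.
    have sA' : nbhs (s, t) (fst @^-1` A).
      exact: (@cvg_fst _ _ (nbhs s) (nbhs t) _ _ sA).
    change (within (`[0, 1] `*` `[0, 1]) (nbhs (s, t)) (fst @^-1` A)).
    by rewrite /within /=; near=> z; move=> _; near: z; exact: sA'.
  apply: cvgB; last exact: cvg_cst.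
  (* The loop is continuous only within [0, 1], so the neighbourhood of t is intersected with that
     interval before being pulled back along the second projection. *)
  move/subspace_continuousP : cp => /(_ t t01) ct A tA.
  have pA : nbhs (s, t) (snd @^-1` [set y | y \in `[0, 1] -> A (p y)]).
    exact: (@cvg_snd _ _ (nbhs s) (nbhs t) _ _ (ct _ tA)).
  change (within (`[0, 1] `*` `[0, 1]) (nbhs (s, t)) (fun z => A (p z.2))).
  rewrite /within /=; near=> z; move=> [_ z01]; move: z01; near: z; exact: pA.
move=> t _ /=; rewrite !subrr scale0r scaler0 !addr0 subr0 scale1r.
by rewrite p01 subrr scaler0 !addr0 addrC subrK; split.
Unshelve. all: by end_near. Qed.

Lemma sd_simply_connected : simply_connected R sd_lieGroup.
Proof. exact: simply_connected_rV. Qed.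

(** Left translation by a is affine in b, with linear part b Q(time a), which is therefore its
    differential everywhere. *)
Lemma sd_left_invariant_vf (v a : 'rV[R]_n) :
  left_invariant_vf (G := sd_lieGroup) sd_chart v a = v *m Q (tm a).
Proof.
rewrite /left_invariant_vf.
pose l := mulmxr (Q (tm a)) : {linear 'rV[R]_n -> 'rV[R]_n}.
rewrite (_ : (fun _ => _) = cst a \+ l) //.
have cl : continuous l by exact: continuous_mulmxr.
rewrite deriveD; last first.
- by apply: diff_derivable; exact: linear_differentiable.
- exact: derivable_cst.
rewrite derive_cst add0r deriveE; last exact: linear_differentiable.
by rewrite diff_lin.
Qed.

(** The field depends on a only through its time, and the derivative of Q at 0 is the generator
    because Q(0) is the identity. *)
Lemma sd_derive_vf (v w : 'rV[R]_n) :
  'D_v (fun a : 'rV[R]_n => w *m Q (tm a)) 0 = tm v *: (w *m flow_gen Q).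
Proof.
have dQ m j := is_derive_comp_linear v (@continuous_rcoord R n (flow_time Q))
  (is_derive_flow Q (rcoord (flow_time Q) 0) m j).
have dwQ i j : is_derive (0 : 'rV[R]_n) v
    (fun a : 'rV[R]_n => (w *m Q (tm a)) i j)
    (\sum_m w i m *: (tm v * (Q 0 *m flow_gen Q) m j)).
  rewrite (_ : (fun _ => _) =
      \sum_m w i m *: (fun x => Q (rcoord (flow_time Q) x) m j)).
    apply: is_derive_sum => m; apply: is_deriveZ.
    by have := dQ m j; rewrite linear0.
  by apply/funext => a; rewrite mxE fct_sumE.
apply/rowP => j; rewrite derive_mx.
  rewrite mxE (@derive_val _ _ _ _ _ _ _ (dwQ 0 j)) !mxE mulr_sumr.
  rewrite flow_mx0 mul1mx.
  by apply: eq_bigr => m _; rewrite /GRing.scale/=; ring.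
by apply/derivable_mxP => i m; have [] := dwQ i m.
Qed.

Lemma sd_tangent_bracket (v w : 'rV[R]_n) :
  tangent_bracket (G := sd_lieGroup) sd_chart v w =
  tm v *: (w *m flow_gen Q) - tm w *: (v *m flow_gen Q).
Proof.
rewrite /tangent_bracket /vf_bracket !sd_left_invariant_vf.
rewrite (_ : left_invariant_vf _ w = fun a => w *m Q (tm a)); last first.
  by apply/funext => a; rewrite sd_left_invariant_vf.
rewrite (_ : left_invariant_vf _ v = fun a => v *m Q (tm a)); last first.
  by apply/funext => a; rewrite sd_left_invariant_vf.
by rewrite /= mxE flow_mx0 !mulmx1 !sd_derive_vf.
Qed.

Lemma is_lie_algebra_of_sd (L : lieAlgebra R) (f : {linear L -> 'rV[R]_n}) :
  bijective f ->
  (forall x y, f [lie x, y] =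
    tm (f x) *: (f y *m flow_gen Q) - tm (f y) *: (f x *m flow_gen Q)) ->
  is_lie_algebra_of sd_lieGroup L.
Proof.
move=> bf fM; exists sd_chart; split => //; exists f => // x y.
by rewrite sd_tangent_bracket fM.
Qed.

End LieGroup.

(** * Integer lattices *)

Lemma mxOver_intD (R : realType) m n (A B : 'M[R]_(m, n)) :
  A \is a mxOver Num.int -> B \is a mxOver Num.int ->
  A + B \is a mxOver Num.int.
Proof.
by move=> /mxOverP SA /mxOverP SB; apply/mxOverP => i j; rewrite mxE rpredD.
Qed.

Lemma mxOver_intN (R : realType) m n (A : 'M[R]_(m, n)) :
  A \is a mxOver Num.int -> - A \is a mxOver Num.int.
Proof. by move=> /mxOverP SA; apply/mxOverP => i j; rewrite mxE rpredN. Qed.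

Section Lattice.
Context {R : realType} {n : nat}.
Variable Q : flow R n.
Hypothesis Q1 : Q 1 \is a mxOver Num.int.
Hypothesis QN1 : Q (- 1) \is a mxOver Num.int.
Local Notation G := (semidirect Q).
Local Notation tm x := ((x : 'rV[R]_n) 0 (flow_time Q)).

(** At an integer, the one-parameter group is a power of Q(1) or of Q(-1). *)
Lemma flow_int (m : int) : Q m%:~R \is a mxOver Num.int.
Proof.
have int1 : (1%:M : 'M[R]_n) \is a mxOver Num.int.
  by apply: mxOver_scalar; rewrite ?rpred0 ?rpred1.
have Qn (k : nat) :
    Q k%:R \is a mxOver Num.int /\ Q (- k%:R) \is a mxOver Num.int.
  elim: k => [|k [IH1 IH2]]; first by rewrite oppr0 flow_mx0.
  by rewrite -natr1 opprD !flow_mxD !mxOverM.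
by case: m => k; [have [] := Qn k|rewrite NegzE mulrNz; have [] := Qn k.+1].
Qed.

Definition sd_int_set : set G := [set x | (x : 'rV[R]_n) \is a mxOver Num.int].

(** This is what closes the integer points under the twisted product and inverse. *)
Lemma flow_time_int (x : 'rV[R]_n) :
  x \is a mxOver Num.int -> Q (tm x) \is a mxOver Num.int.
Proof. by move=> /mxOverP/(_ 0 (flow_time Q))/intrP[m ->]; exact: flow_int. Qed.

Lemma sd_int1 : sd_int_set 1%g.
Proof. by apply/mxOverP => i j; rewrite mxE rpred0. Qed.

Lemma sd_intM x y : sd_int_set x -> sd_int_set y -> sd_int_set (x * y)%g.
Proof.
move=> Sx Sy.
change ((x : 'rV[R]_n) + (y : 'rV[R]_n) *m Q (tm x) \is a mxOver Num.int).
apply: mxOver_intD => //; apply: mxOverM => //.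
exact: flow_time_int.
Qed.

Lemma sd_intV x : sd_int_set x -> sd_int_set (x^-1)%g.
Proof.
move=> Sx; change (- (x : 'rV[R]_n) *m Q (- tm x) \is a mxOver Num.int).
apply: mxOverM; first exact: mxOver_intN.
have -> : - tm x = tm (- (x : 'rV_n)) by rewrite mxE.
by apply: flow_time_int; exact: mxOver_intN.
Qed.

Definition sd_int : subgroup G := Subgroup sd_int1 sd_intM sd_intV.

(** Distinct integer points differ by at least 1 in some coordinate, so the open unit ball of the
    maximum norm separates them. *)
Lemma sd_int_isolated (x : G) : sd_int_set x -> isolated sd_int_set x.
Proof.
move=> Sx; split; first exact/mem_set.
exists (ball (x : 'rV[R]_n) 1); first exact: (@nbhsx_ballx _ 'rV[R]_n).
apply/seteqP; split=> [y [xy Sy]|_ ->]; last by split => //; exact: ballxx.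
apply/rowP => i; apply/eqP; rewrite -subr_eq0; apply/eqP.
have /(norm_intr_ge1)/implyP : (y : 'rV_n) 0 i - (x : 'rV_n) 0 i \is a Num.int.
  by rewrite rpredB//; [exact: (mxOverP Sy)|exact: (mxOverP Sx)].
case: eqP => //= _.
move: xy; rewrite -ball_normE/= [X in (X < _) -> _]/Num.Def.normr/=.
rewrite mx_normrE => xy.
have := le_lt_trans
  (le_bigmax _ (fun a => `|(x - y : 'rV[R]_n) a.1 a.2|) (0, i)) xy.
by rewrite !mxE/= distrC ltNge => /negP.
Qed.

(* Thus every coset x S contains the inverse of a point of a compact cube. *)
Lemma sd_int_meets (x : G) :
  exists2 u : 'rV[R]_n, (forall i, - 1 <= u 0 i <= 0) &
    sd_int_set ((u : G) * x)%g.
Proof.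
(* The time of u must be known in advance, since Q(time u) acts on x. The choice is consistent: the
   flow preserves time, so y has the time of x, and rounding y down gives u the time s. *)
pose s : R := (Num.floor (tm x))%:~R - tm x.
pose y := x *m Q s.
pose u : 'rV[R]_n := \row_i ((Num.floor (y 0 i))%:~R - y 0 i).
have us : tm u = s by rewrite mxE /y flow_timeE.
exists u.
  move=> i; rewrite mxE; have := floor_itv (y 0 i).
  by rewrite intrD => /andP[]; move: (_%:~R) => a ? ?; apply/andP; split; lra.
change ((u : 'rV[R]_n) + (x : 'rV[R]_n) *m Q (tm u) \is a mxOver Num.int).
apply/mxOverP => i j; rewrite ord1 mxE us -/y mxE subrK.
exact: intr_int.
Qed.

Lemma sd_int_lattice : lattice sd_int.
Proof.
split; first exact: sd_int_isolated.
pose K := [set u : 'rV[R]_n | forall i, u 0 i \in `[- 1, (0 : R)]].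
have cK : compact K.
  apply: (@rV_compact _ _ (fun=> [set` `[- 1, (0 : R)]])) => i.
  exact: segment_compact.
pose T := quotient_topology {eq_quot (coset_equiv sd_int)}%qT.
(* The whole quotient is a continuous image of the compact cube, by inversion followed by
   projection. *)
rewrite (_ : setT = (\pi_T%qT : G -> T) @` ((fun x : G => x^-1%g) @` K)).
  apply: continuous_compact.
    apply: continuous_subspaceT; exact: pi_continuous.
  apply: continuous_compact => //.
  apply: continuous_subspaceT; exact: sd_inv_continuous.
apply/seteqP; split=> // q _.
have [u uK Sux] := sd_int_meets (repr q).
exists (u : G)^-1%g; first by exists u => // i; rewrite in_itv/=; exact: uK.
(* From u x in S follows x^-1 u^-1 = (u x)^-1 in S, which puts x and u^-1 in the same left coset. *)
rewrite -[RHS]reprK; apply/esym/eqmodP/asboolP.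
by rewrite -invgM; exact: sd_intV.
Qed.

Lemma admits_compact_quotients_sd (L : lieAlgebra R)
    (f : {linear L -> 'rV[R]_n}) :
  bijective f ->
  (forall x y, f [lie x, y] =
    tm (f x) *: (f y *m flow_gen Q) - tm (f y) *: (f x *m flow_gen Q)) ->
  admits_compact_quotients L.
Proof.
move=> bf fM; exists n, (sd_lieGroup Q); split.
- exact: sd_simply_connected.
- exact: is_lie_algebra_of_sd bf fM.
- exists sd_int; exact: sd_int_lattice.
Qed.

End Lattice.

(** * Compact quotients of the two models *)

Section Planar.
Context {R : realType}.

(* Index 2 is the time coordinate; the rotation or hyperbolic flow acts on the
   plane of the indices 0 and 1. *)
Definition planar_mx (a b c d : R) : 'M[R]_4 := \matrix_(i < 4, j < 4)
  nth 0 (nth [::] [:: [:: a; b; 0; 0]; [:: c; d; 0; 0];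
                      [:: 0; 0; 1; 0]; [:: 0; 0; 0; 1]] i) j.

Definition planar_gen (a b c d : R) : 'M[R]_4 := \matrix_(i < 4, j < 4)
  nth 0 (nth [::] [:: [:: a; b; 0; 0]; [:: c; d; 0; 0]] i) j.

Lemma planar_mx1 : planar_mx 1 0 0 1 = 1%:M.
Proof.
by apply/matrixP => -[[|[|[|[|//]]]] ?] [[|[|[|[|//]]]] ?]; rewrite !mxE.
Qed.

Lemma planar_mxM a b c d a' b' c' d' :
  planar_mx a b c d *m planar_mx a' b' c' d' =
  planar_mx (a * a' + b * c') (a * b' + b * d')
    (c * a' + d * c') (c * b' + d * d').
Proof.
by apply/matrixP => -[[|[|[|[|//]]]] ?] [[|[|[|[|//]]]] ?];
  rewrite !mxE !big_ord_recl big_ord0 !mxE /=; ring.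
Qed.

Lemma planar_mxM_gen a b c d a' b' c' d' :
  planar_mx a b c d *m planar_gen a' b' c' d' =
  planar_gen (a * a' + b * c') (a * b' + b * d')
    (c * a' + d * c') (c * b' + d * d').
Proof.
by apply/matrixP => -[[|[|[|[|//]]]] ?] [[|[|[|[|//]]]] ?];
  rewrite !mxE !big_ord_recl big_ord0 !mxE /=; ring.
Qed.

Lemma is_derive_planar_mx (a b c d : R -> R) (a' b' c' d' s : R) i j :
  is_derive s (1 : R) a a' -> is_derive s (1 : R) b b' ->
  is_derive s (1 : R) c c' -> is_derive s (1 : R) d d' ->
  is_derive s (1 : R) (fun t => planar_mx (a t) (b t) (c t) (d t) i j)
    (planar_gen a' b' c' d' i j).
Proof.
move=> da db dc dd.
rewrite (_ : (fun _ => _) = nth (cst 0) (nth [::]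
    [:: [:: a; b; cst 0; cst 0]; [:: c; d; cst 0; cst 0];
        [:: cst 0; cst 0; cst 1; cst 0]; [:: cst 0; cst 0; cst 0; cst 1]] i) j).
  rewrite mxE; case: i j => [[|[|[|[|//]]]] ?] [[|[|[|[|//]]]] ?] //=;
    exact: is_derive_cst.
apply/funext => t; rewrite mxE.
by case: i j => [[|[|[|[|//]]]] ?] [[|[|[|[|//]]]] ?].
Qed.

(** One pair with C' = k S and S' = C serves both models: cos(wt) and sin(wt)/w for k = -w^2,
    cosh(wt) and sinh(wt)/w for k = w^2. *)
Variables (p q r : R) (C S : R -> R).
Let k := p ^+ 2 + q * r.
Hypothesis C0 : C 0 = 1.
Hypothesis S0 : S 0 = 0.
Hypothesis CD : forall s t, C (s + t) = C s * C t + k * (S s * S t).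
Hypothesis SD : forall s t, S (s + t) = S s * C t + C s * S t.
Hypothesis dC : forall s, is_derive s (1 : R) C (k * S s).
Hypothesis dS : forall s, is_derive s (1 : R) S (C s).

(* exp (t B) = C t + S t B for the traceless B = [[p, q], [r, - p]], whose
   square is the scalar k. *)
Let Q t := planar_mx (C t + p * S t) (q * S t) (r * S t) (C t - p * S t).

Lemma planar_flow0 : Q 0 = 1%:M.
Proof. by rewrite -planar_mx1 /Q C0 S0 !mulr0 addr0 subr0. Qed.

Lemma planar_flowD s t : Q (s + t) = Q s *m Q t.
Proof. by rewrite planar_mxM /Q CD SD /k; congr planar_mx; ring. Qed.

(** From B^2 = k on the plane, (C + S B) B = k S + C B, the derivative of C + S B. *)
Lemma is_derive_planar_flow s i j : is_derive s (1 : R) (fun t => Q t i j)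
  ((Q s *m planar_gen p q r (- p)) i j).
Proof.
have dCS b : is_derive s (1 : R) (fun t => C t + b * S t) (k * S s + b * C s).
  by apply: is_deriveD; apply: is_deriveZ.
have dS' b : is_derive s (1 : R) (fun t => b * S t) (b * C s).
  exact: is_deriveZ.
rewrite planar_mxM_gen /Q; apply: is_derive_planar_mx.
- by apply: is_derive_eq; rewrite /k; ring.
- by apply: is_derive_eq; rewrite /k; ring.
- by apply: is_derive_eq; rewrite /k; ring.
- rewrite (_ : (fun _ => _) = fun t => C t + (- p) * S t).
    by apply: is_derive_eq; rewrite /k; ring.
  by apply/funext => t; rewrite mulNr.
Qed.

Lemma planar_flow_time (x : 'rV[R]_4) s : (x *m Q s) 0 2 = x 0 2.
Proof.
rewrite mxE !big_ord_recl big_ord0 !mxE /= !mulr0 !add0r mulr1 !addr0.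
by congr (x 0 _); apply/val_inj.
Qed.

Definition planar_flow : flow R 4 :=
  Flow planar_flow0 planar_flowD is_derive_planar_flow planar_flow_time.

Lemma planar_flow_int t :
  C t + p * S t \is a Num.int -> q * S t \is a Num.int ->
  r * S t \is a Num.int -> C t - p * S t \is a Num.int ->
  planar_flow t \is a mxOver Num.int.
Proof.
move=> ? ? ? ?; apply/mxOverP => i j; rewrite mxE.
by case: i j => [[|[|[|[|//]]]] ?] [[|[|[|[|//]]]] ?] /=;
  rewrite ?rpred0 ?rpred1.
Qed.

End Planar.

(** * The rotation model and the hyperbolic model *)

Section Examples.
Context {R : realType}.

Definition row4 (a b c d : R) : 'rV[R]_4 :=
  \row_(i < 4) nth 0 [:: a; b; c; d] i.

Lemma row4P (x y : 'rV[R]_4) : x 0 0 = y 0 0 -> x 0 1 = y 0 1 ->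
  x 0 2 = y 0 2 -> x 0 3 = y 0 3 -> x = y.
Proof.
move=> h0 h1 h2 h3; apply/rowP => -[[|[|[|[|//]]]] lti].
- by rewrite (_ : Ordinal _ = 0)//; apply/val_inj.
- by rewrite (_ : Ordinal _ = 1)//; apply/val_inj.
- by rewrite (_ : Ordinal _ = 2)//; apply/val_inj.
- by rewrite (_ : Ordinal _ = 3)//; apply/val_inj.
Qed.

Lemma mul_planar_gen (x : 'rV[R]_4) a b c d :
  x *m planar_gen a b c d =
  row4 (x 0 0 * a + x 0 1 * c) (x 0 0 * b + x 0 1 * d) 0 0.
Proof.
have e1 : lift ord0 ord0 = 1 :> 'I_4 by apply/val_inj.
by apply: row4P; rewrite !mxE !big_ord_recl big_ord0 !mxE /= e1; ring.
Qed.

Lemma A36A1_compact_quotients : admits_compact_quotients (A36A1 R).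
Proof.
(* With angular speed 2 pi, the flow at times 1 and -1 is a full turn, that is, the identity. *)
have [w wE w0] : exists2 w : R, w = pi *+ 2 & w != 0.
  by exists (pi *+ 2) => //; rewrite mulrn_eq0 /= gt_eqF// pi_gt0.
pose C (t : R) := cos (w * t).
pose S (t : R) := sin (w * t) / w.
have CD s t : C (s + t) = C s * C t + (0 ^+ 2 + w * - w) * (S s * S t).
  by rewrite /C /S mulrDr cosD; field.
have SD s t : S (s + t) = S s * C t + C s * S t.
  by rewrite /C /S mulrDr sinD; field.
have dC s : is_derive s (1 : R) C ((0 ^+ 2 + w * - w) * S s).
  have := is_derive_comp_scale (is_derive_cos (w * s)).
  by move=> /is_derive_eq; apply; rewrite /S; field.
have dS s : is_derive s (1 : R) S (C s).
  have := is_deriveZ w^-1 (is_derive_comp_scale (is_derive_sin (w * s))).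
  rewrite (_ : w^-1 \*: _ = S); last first.
    by apply/funext => t; exact: mulrC.
  by move=> /is_derive_eq; apply; rewrite /C /GRing.scale /=; field.
have C0 : C 0 = 1 by rewrite /C mulr0 cos0.
have S0 : S 0 = 0 by rewrite /S mulr0 sin0 mul0r.
have C1 : C 1 = 1 by rewrite /C mulr1 wE cos2pi.
have S1 : S 1 = 0 by rewrite /S mulr1 wE sin2pi mul0r.
have CN1 : C (- 1) = 1 by rewrite /C mulrN1 cosN wE cos2pi.
have SN1 : S (- 1) = 0 by rewrite /S mulrN1 sinN wE sin2pi oppr0 mul0r.
pose Q := planar_flow C0 S0 CD SD dC dS.
(* Dividing the time coordinate by w compensates for the factor w in the generator. *)
pose f (x : A36A1 R) : 'rV[R]_4 :=
  row4 ((x : 'rV_4) 0 0) ((x : 'rV_4) 0 1)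
    ((x : 'rV_4) 0 2 / w) ((x : 'rV_4) 0 3).
have lf : linear f.
  by move=> a x y; apply: row4P; rewrite !mxE/= ?mulrDl ?mulrA.
pose F : {linear A36A1 R -> 'rV[R]_4} :=
  HB.pack f (GRing.isLinear.Build R (A36A1 R) 'rV[R]_4 _ f lf).
apply: (@admits_compact_quotients_sd R 4 Q _ _ _ F).
- by apply: (@planar_flow_int _ 0 w (- w) C S C0 S0 CD SD dC dS);
    rewrite ?C1 ?S1 !mulr0 ?addr0 ?subr0 ?rpred1 ?rpred0.
- by apply: (@planar_flow_int _ 0 w (- w) C S C0 S0 CD SD dC dS);
    rewrite ?CN1 ?SN1 !mulr0 ?addr0 ?subr0 ?rpred1 ?rpred0.
- exists (fun x : 'rV[R]_4 => row4 (x 0 0) (x 0 1) (x 0 2 * w) (x 0 3)) => x.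
    by apply: row4P; rewrite !mxE/= ?divfK.
  by apply: row4P; rewrite !mxE/= ?mulfK.
- move=> x y; rewrite !mul_planar_gen.
  by apply: row4P; rewrite !mxE/=; field.
Qed.

Lemma A34A1_compact_quotients : admits_compact_quotients (A34A1 R).
Proof.
(* The flow is chosen such that Q(1) acts on the plane by [[2, 1], [1, 1]], with
   eigenvalue (3 + q5) / 2. *)
have [q5 q50 q5E] : exists2 q5 : R, 0 < q5 & q5 ^+ 2 = 5.
  by exists (Num.sqrt 5); [rewrite sqrtr_gt0|rewrite sqr_sqrtr].
have q5n0 : q5 != 0 by rewrite gt_eqF.
have [w ew w0] : exists2 w : R, expR w = (3 + q5) / 2 & w != 0.
  exists (ln ((3 + q5) / 2)); first by rewrite lnK// posrE; lra.
  by rewrite gt_eqF// ln_gt0//; lra.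
pose C (t : R) := (expR (w * t) + expR (- w * t)) / 2.
pose S (t : R) := (expR (w * t) - expR (- w * t)) / (2 * w).
(* The generator (w / q5) [[1, 2], [2, -1]] has square w^2 and is the logarithm of [[2, 1],
   [1, 1]]. *)
pose p := w / q5.
pose q := 2 * w / q5.
have kE : p ^+ 2 + q * q = w ^+ 2.
  by rewrite /p /q; field: q5E.
have CD s t : C (s + t) = C s * C t + (p ^+ 2 + q * q) * (S s * S t).
  by rewrite kE /C /S !mulrDr !expRD; field.
have SD s t : S (s + t) = S s * C t + C s * S t.
  by rewrite /C /S !mulrDr !expRD; field.
have dC s : is_derive s (1 : R) C ((p ^+ 2 + q * q) * S s).
  have := is_deriveZ 2^-1 (is_deriveD
    (is_derive_comp_scale (is_derive_expR (w * s)))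
    (is_derive_comp_scale (is_derive_expR (- w * s)))).
  rewrite (_ : _ \*: _ = C); last by apply/funext => t; exact: mulrC.
  by move=> /is_derive_eq; apply; rewrite kE /S /GRing.scale /=; field.
have dS s : is_derive s (1 : R) S (C s).
  have := is_deriveZ (2 * w)^-1 (is_deriveB
    (is_derive_comp_scale (is_derive_expR (w * s)))
    (is_derive_comp_scale (is_derive_expR (- w * s)))).
  rewrite (_ : _ \*: _ = S); last by apply/funext => t; exact: mulrC.
  by move=> /is_derive_eq; apply; rewrite /C /GRing.scale /=; field.
have C0 : C 0 = 1 by rewrite /C !mulr0 expR0; field.
have S0 : S 0 = 0 by rewrite /S !mulr0 expR0 subrr mul0r.
have eNw : expR (- w) = (3 - q5) / 2.
  rewrite expRN ew; field: q5E.
  by rewrite gt_eqF//; lra.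
have C1 : C 1 = 3 / 2 by rewrite /C !mulr1 ew eNw; field.
have S1 : S 1 = q5 / (2 * w) by rewrite /S !mulr1 ew eNw; field.
have CN1 : C (- 1) = 3 / 2 by rewrite /C !mulrN1 opprK ew eNw; field.
have SN1 : S (- 1) = - (q5 / (2 * w)) by rewrite /S !mulrN1 opprK ew eNw; field.
pose Q := planar_flow C0 S0 CD SD dC dS.
(* The vectors e_1 and e_2 go to row eigenvectors of the generator for the eigenvalues -w and w; the
   rescaled time turns these into -1 and 1, as the model requires. *)
pose f (x : A34A1 R) : 'rV[R]_4 :=
  row4 ((x : 'rV_4) 0 0 + (x : 'rV_4) 0 1)
    (- (1 + q5) / 2 * (x : 'rV_4) 0 0 + (q5 - 1) / 2 * (x : 'rV_4) 0 1)
   ((x : 'rV_4) 0 2 / w) ((x : 'rV_4) 0 3).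
have lf : linear f.
  by move=> a x y; apply: row4P; rewrite !mxE/=; field.
pose F : {linear A34A1 R -> 'rV[R]_4} :=
  HB.pack f (GRing.isLinear.Build R (A34A1 R) 'rV[R]_4 _ f lf).
have int m : m%:~R \is a @Num.int R by exact: intr_int.
apply: (@admits_compact_quotients_sd R 4 Q _ _ _ F).
- apply: (@planar_flow_int _ p q q C S C0 S0 CD SD dC dS);
    rewrite ?C1 ?S1 /p /q.
  + by rewrite (_ : _ + _ = 2%:~R)//; field; rewrite ?q5n0 ?w0.
  + by rewrite (_ : _ * _ = 1%:~R)//; field; rewrite ?q5n0 ?w0.
  + by rewrite (_ : _ * _ = 1%:~R)//; field; rewrite ?q5n0 ?w0.
  + by rewrite (_ : _ - _ = 1%:~R)//; field; rewrite ?q5n0 ?w0.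
(* Q(-1) acts by the inverse [[1, -1], [-1, 2]], integral because the determinant is 1. *)
- apply: (@planar_flow_int _ p q q C S C0 S0 CD SD dC dS);
    rewrite ?CN1 ?SN1 /p /q.
  + by rewrite (_ : _ + _ = 1%:~R)//; field; rewrite ?q5n0 ?w0.
  + by rewrite (_ : _ * _ = (- 1)%:~R)//; field; rewrite ?q5n0 ?w0.
  + by rewrite (_ : _ * _ = (- 1)%:~R)//; field; rewrite ?q5n0 ?w0.
  + by rewrite (_ : _ - _ = 2%:~R)//; field; rewrite ?q5n0 ?w0.
- exists (fun x : 'rV[R]_4 => row4
    (((q5 - 1) / 2 * x 0 0 - x 0 1) / q5)
    (((1 + q5) / 2 * x 0 0 + x 0 1) / q5) (x 0 2 * w) (x 0 3)) => x.
    by apply: row4P; rewrite !mxE/= ?divfK//; field.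
  by apply: row4P; rewrite !mxE/= ?mulfK//; field.
- move=> x y; rewrite !mul_planar_gen /p /q.
  by apply: row4P; rewrite !mxE/=; field: q5E; rewrite ?q5n0 ?w0.
Qed.

End Examples.

(** * The classification *)

(** Unimodularity is stated in the basis [vbasis]; invariance of the trace under change of basis
    lets it be read off in an adapted one. *)
Lemma mxtrace_basis (F : fieldType) (vT : vectType F) n (e : n.-tuple vT)
    (f : 'End(vT)) : basis_of {:vT} e ->
  \tr (passmx.mxof (vbasis {:vT}) (vbasis {:vT}) f) =
  \sum_i coord e i (f e`_i).
Proof.
move=> eb; have En : n = \dim {:vT} by rewrite (size_basis eb).
subst n; set b := vbasis _.
have bb : basis_of {:vT} b by exact: vbasisP.
have -> : passmx.mxof b b f =
    passmx.mxof b e \1%VF *m (passmx.mxof e e f *m passmx.mxof e b \1%VF).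
  by rewrite -!passmx.mxof_comp ?comp_lfun1l ?comp_lfun1r.
rewrite mxtrace_mulC -mulmxA -passmx.mxof_comp// comp_lfun1l.
rewrite passmx.mxof1 ?(basis_free eb)// mulmx1.
by apply: eq_bigr => i _; rewrite mxE /= passmx.vecof_delta mxE.
Qed.

Lemma coord_row_bij (F : fieldType) (vT : vectType F) n (e : n.-tuple vT) :
  basis_of {:vT} e ->
  exists2 phi : {linear vT -> 'rV[F]_n}, bijective phi &
    forall x i, phi x 0 i = coord e i x.
Proof.
move=> eb; have En : n = \dim {:vT} by rewrite (size_basis eb).
subst n.
pose phi : {linear vT -> 'rV[F]_(\dim {:vT})} := HB.pack (passmx.rVof e)
  (GRing.isLinear.Build F vT 'rV[F]_(\dim {:vT}) _ _ (passmx.rVof_linear e)).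
exists phi => [|x i]; last by rewrite mxE.
by exists (passmx.vecof e); [exact: passmx.rVofK|exact: passmx.vecofK].
Qed.

(** * Inner products on finite-dimensional spaces *)

Section Dot.
Context {R : realType} {L : vectType R}.
Variable g : {dot L for idfun}.

Lemma dotC x y : g x y = g y x.
Proof. by rewrite hermC /= expr0 mul1r. Qed.

Lemma dotDl x y z : g (x + y) z = g x z + g y z. Proof. exact: linearDl. Qed.
Lemma dotZl a x z : g (a *: x) z = a * g x z. Proof. exact: linearZl_LR. Qed.
Lemma dotNl x z : g (- x) z = - g x z. Proof. exact: linearNl. Qed.
Lemma dotNr x z : g z (- x) = - g z x. Proof. by rewrite dotC dotNl dotC. Qed.
Lemma dotZr a x z : g z (a *: x) = a * g z x.
Proof. by rewrite dotC dotZl dotC. Qed.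
Lemma dotDr x y z : g z (x + y) = g z x + g z y.
Proof. by rewrite dotC dotDl !(dotC z). Qed.
Lemma dot0l z : g 0 z = 0. Proof. exact: linear0l. Qed.

Lemma dot_gt0 x : x != 0 -> 0 < g x x.
Proof. exact: neq0_dnorm_gt0. Qed.

Lemma dot_eq0 x : (forall y, g x y = 0) -> x = 0.
Proof.
by move=> gx0; apply/eqP/negPn/negP => /dot_gt0; rewrite gx0 ltxx.
Qed.

Lemma dot_suml I (r : seq I) (E : I -> L) z :
  g (\sum_(i <- r) E i) z = \sum_(i <- r) g (E i) z.
Proof. by elim/big_ind2: _ => [|u a v b <- <-|//]; rewrite ?dot0l ?dotDl. Qed.

(** Pairing with the members of s maps L to a space of smaller dimension, so its kernel is
    non-zero. *)
Lemma exists_orthogonal (s : seq L) : (size s < \dim {:L})%N ->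
  exists2 x, x != 0 & forall y, y \in s -> g x y = 0.
Proof.
move=> ss; pose f (x : L) : 'rV[R]_(size s) := \row_i g x s`_i.
have lf : linear f.
  by move=> a x y; apply/rowP => i; rewrite !mxE dotDl dotZl.
pose F : {linear L -> 'rV[R]_(size s)} :=
  HB.pack f (GRing.isLinear.Build R L 'rV[R]_(size s) _ f lf).
have ker0 : lker (linfun F) != 0%VS.
  apply: contraTneq ss => ker0; rewrite -leqNgt.
  rewrite -(limg_ker_dim (linfun F)) ker0 capv0 dimv0 add0n.
  by rewrite (leq_trans (dimvS (subvf _)))// dimvf dim_matrix mul1r.
exists (vpick (lker (linfun F))); first by rewrite vpick0.
move=> y ys; have := memv_pick (lker (linfun F)).
rewrite memv_ker lfunE /= => /eqP/rowP.
move=> /(_ (Ordinal (etrans (index_mem y s) ys))).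
by rewrite !mxE /= nth_index.
Qed.

(** Take n orthogonal to a basis of h. The kernel of the form g(n, .) contains h and is proper since
    g(n, n) > 0, so the dimensions force equality. *)
Lemma exists_normal (h : {vspace L}) : (\dim h).+1 = \dim {:L} ->
  exists2 n, n != 0 & forall x, (x \in h) = (g n x == 0).
Proof.
move=> dh; have [|n n0 nh] := @exists_orthogonal (vbasis h).
  by rewrite size_tuple dh.
exists n => // .
have gn y : y \in h -> g n y = 0.
  move=> /coord_vbasis ->; rewrite dotC dot_suml big1// => i _.
  by rewrite dotZl dotC nh ?mulr0// mem_nth// size_tuple.
pose G : {linear L -> R^o} :=
  HB.pack (g n : L -> R^o) (GRing.isLinear.Build R L R^o _ (g n : L -> R^o)
    (fun a x y => etrans (dotDr _ _ _) (congr1 (+%R^~ _) (dotZr _ _ _)))).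
have hk : (h <= lker (linfun G))%VS.
  by apply/subvP => x /gn gx; rewrite memv_ker lfunE/= gx.
have kerE : h == lker (linfun G).
  rewrite eqEdim hk -ltnS dh -(limg_ker_dim (linfun G) fullv) capfv.
  rewrite -addn1 leq_add2l.
  rewrite lt0n dimv_eq0 -subv0; apply/negP => /subvP/(_ (linfun G n)).
  rewrite memv_img ?memvf// => /(_ isT); rewrite memv0 lfunE /=.
  by rewrite gt_eqF// dot_gt0.
by move=> x; rewrite (eqP kerE) memv_ker lfunE.
Qed.

(** A non-zero form is proportional to the pairing with a normal n of its kernel; evaluation at n
    gives the factor. *)
Lemma riesz (t : {scalar L}) : exists w, forall x, t x = g w x.
Proof.
have [[x0 tx0]|t0] := pselect (exists x, t x != 0); last first.
  exists 0 => x; rewrite dot0l; apply/eqP/negPn/negP => tx.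
  by apply: t0; exists x.
have dk : (\dim (lker (linfun (t : L -> R^o)))).+1 = \dim {:L}.
  rewrite -(limg_ker_dim (linfun (t : L -> R^o)) fullv) capfv -addn1.
  congr addn; apply/esym/eqP; rewrite eqn_leq; apply/andP; split.
    by rewrite (leq_trans (dimvS (subvf _)))// dimvf.
  rewrite lt0n dimv_eq0 -subv0; apply/negP.
  move=> /subvP/(_ (linfun (t : L -> R^o) x0)).
  rewrite memv_img ?memvf// => /(_ isT); rewrite memv0 lfunE /=.
  exact/negP.
have [n n0 nk] := exists_normal dk.
have tn x : (t x == 0) = (g n x == 0) by rewrite -nk memv_ker lfunE.
have gn : g n n != 0 by rewrite gt_eqF// dot_gt0.
exists ((t n / g n n) *: n) => x; rewrite dotZl.
have /eqP : t (x - (g n x / g n n) *: n) == 0.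
  by rewrite tn dotDr dotNr dotZr divfK// subrr.
rewrite linearB linearZ /= => /eqP; rewrite subr_eq0 => /eqP -> /=.
by rewrite mulrAC -mulrA mulrC.
Qed.

(** Pairing a combination with a basis vector isolates one coefficient. The vectors are not
    normalised, hence the division by the squared length. *)
Lemma orthogonal_basis n (e : n.-tuple L) : n = \dim {:L} ->
  (forall i j : 'I_n, g e`_i e`_j = if i == j then g e`_i e`_i else 0) ->
  (forall i : 'I_n, e`_i != 0) ->
  basis_of {:L} e /\ forall i x, coord e i x = g x e`_i / g e`_i e`_i.
Proof.
move=> En eo en0.
have cE k (i : 'I_n) : g (\sum_(j < n) k j *: e`_j) e`_i = k i * g e`_i e`_i.
  rewrite dot_suml (bigD1 i)//= dotZl big1 ?addr0// => j ji.
  by rewrite dotZl eo (negPf ji) mulr0.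
have ge (i : 'I_n) : g e`_i e`_i != 0 by rewrite gt_eqF// dot_gt0 ?en0.
have eb : basis_of {:L} e.
  rewrite basisEfree subvf size_tuple -En leqnn !andbT.
  apply/freeP => k k0 i; have := cE k i; rewrite k0 dot0l => /esym/eqP.
  by rewrite mulf_eq0 (negPf (ge i)) orbF => /eqP.
split=> // i x; rewrite {2}(coord_basis eb (memvf x)) cE mulfK//.
Qed.

End Dot.

(** * Almost-Hermitian Lie algebras and their normal form *)

Section LieBracket.
Context {R : realType} {L : lieAlgebra R}.
Implicit Types x y z : L.

Lemma lie_brDl x y z : [lie x + y, z] = [lie x, z] + [lie y, z].
Proof. exact: linearDl. Qed.

Lemma lie_brDr x y z : [lie z, x + y] = [lie z, x] + [lie z, y].
Proof. exact: linearDr. Qed.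

Lemma lie_brZl c x z : [lie c *: x, z] = c *: [lie x, z].
Proof. exact: linearZl_LR. Qed.

Lemma lie_brZr c x z : [lie z, c *: x] = c *: [lie z, x].
Proof. exact: linearZr_LR. Qed.

Lemma lie_brC x y : [lie x, y] = - [lie y, x].
Proof.
have := lie_alt (x + y); rewrite lie_brDl !lie_brDr !lie_alt add0r addr0.
by move/eqP; rewrite addr_eq0 => /eqP.
Qed.

Variable h : almostHermitian L.

Lemma ah_gJr x y : ah_g h (ah_J h x) y = - ah_g h x (ah_J h y).
Proof. by rewrite -[LHS]ah_gJ ah_JJ dotNl. Qed.

Lemma ah_gJxx x : ah_g h (ah_J h x) x = 0.
Proof. by have := ah_gJr x x; rewrite (dotC _ x (ah_J h x)); lra. Qed.

End LieBracket.

(** With v_0, ..., v_3 the basis behind [phi], ad v_0 maps v_1 to c v_3 and v_3 to b v_1, so its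
    square on their span is b c, and v_2 is central. The sign of b decides between imaginary and
    real eigenvalues. *)
Lemma lie_isomorphic_row4 (R : realType) (L : lieAlgebra R)
    (phi : {linear L -> 'rV[R]_4}) (b c : R) :
  bijective phi -> b != 0 -> 0 < c ->
  (forall x y, phi [lie x, y] = row4
     0 (b * (phi x 0 0 * phi y 0 3 - phi x 0 3 * phi y 0 0))
     0 (c * (phi x 0 0 * phi y 0 1 - phi x 0 1 * phi y 0 0))) ->
  lie_isomorphic L (A36A1 R) \/ lie_isomorphic L (A34A1 R).
Proof.
move=> bphi b0 c0 phiE; have cn0 : c != 0 by rewrite gt_eqF.
have [bneg|bpos|/eqP] := ltgtP b 0; last by rewrite (negPf b0).
- have [l l0 lE] : exists2 l : R, l != 0 & l ^+ 2 = - (b * c).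
    exists (Num.sqrt (- (b * c))); last first.
      by rewrite sqr_sqrtr// oppr_ge0 nmulr_rle0// ltW.
    by rewrite gt_eqF// sqrtr_gt0 oppr_gt0 nmulr_rlt0.
  left.
  pose f (v : 'rV[R]_4) : A36A1 R :=
    row4 (v 0 1 / l) (v 0 3 / c) (l * v 0 0) (v 0 2).
  have lf : linear (f \o phi).
    move=> a x y; rewrite /= linearP.
    by apply: row4P; rewrite !mxE/=; field; rewrite ?l0 ?cn0.
  pose F : {linear L -> A36A1 R} := HB.pack (f \o phi)
    (GRing.isLinear.Build R L (A36A1 R) _ (f \o phi) lf).
  exists F.
    apply: bij_comp => //.
    exists (fun v : 'rV[R]_4 =>
      row4 (v 0 2 / l) (v 0 0 * l) (v 0 3) (v 0 1 * c)) => v;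
      by apply: row4P; rewrite !mxE/=; field; rewrite ?l0 ?cn0.
  move=> x y; rewrite /= phiE.
  by apply: row4P; rewrite !mxE /=; field: lE; rewrite ?l0 ?cn0.
- have [l l0 lE] : exists2 l : R, l != 0 & l ^+ 2 = b * c.
    exists (Num.sqrt (b * c)); last by rewrite sqr_sqrtr// mulr_ge0 ?ltW.
    by rewrite gt_eqF// sqrtr_gt0 mulr_gt0.
  right.
  (* The first two entries are coordinates along the eigenvectors l v_1 + c v_3 and - l v_1 + c v_3
     of ad v_0, with eigenvalues l and -l. The sign in - l appears because ad e_3 maps e_1 to - e_1
     in the model. *)
  pose f (v : 'rV[R]_4) : A34A1 R :=
    row4 ((v 0 1 / l + v 0 3 / c) / 2) ((v 0 3 / c - v 0 1 / l) / 2)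
      (- l * v 0 0) (v 0 2).
  have lf : linear (f \o phi).
    move=> a x y; rewrite /= linearP.
    by apply: row4P; rewrite !mxE/=; field; rewrite ?l0 ?cn0.
  pose F : {linear L -> A34A1 R} := HB.pack (f \o phi)
    (GRing.isLinear.Build R L (A34A1 R) _ (f \o phi) lf).
  exists F.
    apply: bij_comp => //.
    exists (fun v : 'rV[R]_4 => row4 (- (v 0 2 / l)) ((v 0 0 - v 0 1) * l)
      (v 0 3) ((v 0 0 + v 0 1) * c)) => v;
      by apply: row4P; rewrite !mxE/=; field; rewrite ?l0 ?cn0.
  move=> x y; rewrite /= phiE.
  by apply: row4P; rewrite !mxE /=; field: lE; rewrite ?l0 ?cn0.
Qed.

Lemma parallel_lee_classification (R : realType) (L : lieAlgebra R)
    (h : almostHermitian L) (theta : {scalar L}) (D : {bilinear L -> L -> L}) :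
  \dim {: L} = 4%N ->
  lie_unimodular L ->
  almost_abelian L ->
  ~ integrable_J h ->
  lee_form h theta ->
  levi_civita h D ->
  parallel_form D theta ->
  (exists x, theta x <> 0) ->
  lie_isomorphic L (A36A1 R) \/ lie_isomorphic L (A34A1 R).
Proof.
move=> dimL unim [a [dima ida aba]] nonint lee [metD torD] parth [z0 thz0].
pose g := ah_g h; pose J := ah_J h.
have JJ x : J (J x) = - x by exact: ah_JJ.
have gJ x y : g (J x) (J y) = g x y by exact: ah_gJ.
have gJr x y : g (J x) y = - g x (J y) by exact: ah_gJr.
have gJxx x : g (J x) x = 0 by exact: ah_gJxx.
have [n n0 an] := exists_normal g dima.
have gnn : g n n != 0 by rewrite gt_eqF// dot_gt0.
have ab0 x y : g n x = 0 -> g n y = 0 -> [lie x, y] = 0.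
  by move=> /eqP + /eqP; rewrite -!an; exact: aba.
have ndec x : exists2 x', g n x' = 0 & x = x' + (g n x / g n n) *: n.
  exists (x - (g n x / g n n) *: n); last by rewrite subrK.
  by rewrite dotDr dotNr dotZr divfK// subrr.
have gbrh x y : g n y = 0 -> g n [lie x, y] = 0.
  by move=> /eqP gy; apply/eqP; rewrite -an ida// an.
(* All brackets lie in the ideal: it has codimension one and [n, n] = 0. *)
have gbr x y : g n [lie x, y] = 0.
  have [[x' gx ->] [y' gy ->]] := (ndec x, ndec y).
  rewrite lie_brDr dotDr gbrh// add0r lie_brZr lie_brDl lie_brZl lie_alt.
  rewrite scaler0 addr0 lie_brC.
  by rewrite dotZr dotNr gbrh// oppr0 mulr0.
have [w thw] := riesz g theta.
have w0 : w != 0.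
  by apply/eqP => w0; apply: thz0; rewrite thw w0 dot0l.
have gww : g w w != 0 by rewrite gt_eqF// dot_gt0.
have gwD x y : g w (D x y) = 0 by rewrite -thw -[LHS]opprK parth oppr0.
have brD x y : [lie x, y] = D x y - D y x.
  by apply/esym/eqP; rewrite -subr_eq0; apply/eqP; exact: torD.
have gwbr x y : g w [lie x, y] = 0.
  by rewrite brD dotDr dotNr !gwD subrr.
(* Metric compatibility turns the parallel form into a parallel vector. *)
have Dw x : D x w = 0.
  apply: (dot_eq0 (g := g)) => y; have := metD x w y.
  by rewrite -/g gwD addr0.
(* The Killing equation for w: [x, w] = - D_w x, and D_w is skew. *)
have skew x y : g [lie x, w] y + g x [lie y, w] = 0.
  rewrite !brD !Dw !sub0r dotNl dotNr -opprD.
  by rewrite (metD w x y) oppr0.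
have dF x y z : - g (J [lie x, y]) z - g (J [lie y, z]) x - g (J [lie z, x]) y =
    g w x * g (J y) z + g w y * g (J z) x + g w z * g (J x) y.
  by have := lee x y z; rewrite /d2form /wedge12 /fundamental_form !thw.
(* The vectors u and J u span the orthogonal of n and J n, so both lie in the abelian ideal. *)
have [u u0 uP] : exists2 u, u != 0 & forall y, y \in [:: n; J n] -> g u y = 0.
  by apply: exists_orthogonal; rewrite dimL.
have gun : g u n = 0 by apply: uP; rewrite inE eqxx.
have guJn : g u (J n) = 0 by apply: uP; rewrite !inE eqxx orbT.
have guu : g u u != 0 by rewrite gt_eqF// dot_gt0.
have gnu : g n u = 0 by rewrite dotC.
have gnJu : g n (J u) = 0 by rewrite dotC gJr guJn oppr0.
have gnJn : g n (J n) = 0 by rewrite dotC gJxx.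
(* dF = theta /\ F on the triple J n, u, J u inside the abelian ideal. *)
have gwJn : g w (J n) = 0.
  have := dF (J n) u (J u); rewrite !ab0// !linear0 !dot0l oppr0 !addr0.
  rewrite gJ !JJ !dotNl guJn gnu oppr0 !mulr0 !addr0 => /esym/eqP.
  by rewrite mulf_eq0 (negPf guu) orbF => /eqP.
(* The Killing equation at (v, v) with v in the ideal: only the n-component of w contributes to
   [v, w]. *)
have skew_n v : g n v = 0 -> g w n * g [lie v, n] v = 0.
  move=> gnv; have [w' gw' wE] := ndec w.
  have := skew v v; rewrite (dotC g v) {1 2}wE lie_brDr ab0// add0r.
  rewrite lie_brZr dotZl => s0.
  have /eqP : g n w / g n n * g [lie v, n] v = 0 by lra.
  by rewrite dotC mulf_eq0 mulf_eq0 invr_eq0 (negPf gnn) orbF -mulf_eq0 => /eqP.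
(* On n, u, J u it expresses g w n through g [u, n] u and g [J u, n] (J u),
   which skew_n annihilates as soon as g w n <> 0. *)
have gwn : g w n = 0.
  have := dF n u (J u); rewrite (ab0 u (J u))// linear0 dot0l gJ.
  rewrite JJ dotNl gun (gJr n u) -/J gnJu (gJr _ u) gJ (lie_brC n u).
  rewrite dotNl => dFu.
  have [s1 s2] := (skew_n u gnu, skew_n (J u) gnJu).
  have /eqP : g w n * g w n * g u u = 0.
    transitivity (g w n * g [lie u, n] u + g w n * g [lie J u, n] (J u)).
      by rewrite -mulrDr -mulrA; congr (_ * _); lra.
    by rewrite s1 s2 addr0.
  by rewrite !mulf_eq0 (negPf guu) orbF orbb => /eqP.
have gnw : g n w = 0 by rewrite dotC.
have gnJw : g n (J w) = 0 by rewrite -[LHS]opprK -gJr dotC gwJn oppr0.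
have gwJw : g w (J w) = 0 by rewrite dotC gJxx.
(* As w lies in the ideal, only [n, w] is in question; by the Killing equation g([n, w], y) = - g(n,
   [y, w]), and brackets are orthogonal to n. *)
have wc x : [lie x, w] = 0.
  have [x' gx ->] := ndec x; rewrite lie_brDl ab0// add0r lie_brZl.
  rewrite (_ : [lie n, w] = 0) ?scaler0//.
  by apply: (dot_eq0 (g := g)) => y; have := skew n y; rewrite gbr addr0.
pose e := [tuple n; J n; w; J w].
have [eb eE] : basis_of {:L} e /\
    forall i x, coord e i x = g x e`_i / g e`_i e`_i.
  have Jn0 : J n != 0 by apply: contra_neq gnn => Jn0; rewrite -gJ Jn0 dot0l.
  have Jw0 : J w != 0 by apply: contra_neq gww => Jw0; rewrite -gJ Jw0 dot0l.
  apply: orthogonal_basis; first by rewrite dimL.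
    by case=> [[|[|[|[|//]]]] ?] [[|[|[|[|//]]]] ?] //=; rewrite ?gJ// dotC ?gJ.
  by case=> [[|[|[|[|//]]]] ?].
pose p := g n n.
have pn0 : p != 0 := gnn.
pose b := g [lie n, J w] (J n) / p.
have dec x : x = (g x n / p) *: n + (g x (J n) / p) *: J n +
    (g x w / g w w) *: w + (g x (J w) / g w w) *: J w.
  rewrite {1}(coord_basis eb (memvf x)) !big_ord_recl big_ord0 !eE /=.
  by rewrite !gJ addr0 !addrA.
(* On n, w, J w the form theta /\ F vanishes, and centrality of w leaves one term of dF. *)
have gJwJw : g [lie n, J w] (J w) = 0.
  have := dF n w (J w); rewrite !wc (lie_brC w) wc oppr0 linear0 !dot0l.
  rewrite gwn gwJw JJ.
  rewrite dotNl gwn gJr (lie_brC _ n) dotNl; lra.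
have brnJw : [lie n, J w] = b *: J n.
  rewrite [LHS]dec (dotC g _ n) gbr (dotC g _ w) gwbr gJwJw !mul0r !scale0r.
  by rewrite add0r !addr0.
(* The other diagonal entries of ad n in the basis [e] vanish, so the zero trace forces this one to
   vanish too. *)
have gJnJn : g [lie n, J n] (J n) = 0.
  have := unim n; rewrite (mxtrace_basis _ eb) !big_ord_recl big_ord0.
  rewrite !eE !lfunE /=.
  rewrite lie_alt wc gJwJw !dot0l !mul0r !addr0 add0r => /eqP.
  by rewrite gJ mulf_eq0 invr_eq0 (negPf gnn) orbF => /eqP.
have brnJn : [lie n, J n] = p *: J w.
  rewrite [LHS]dec (dotC g _ n) gbr (dotC g _ w) gwbr gJnJn !mul0r !scale0r.
  rewrite !add0r; congr (_ *: _).
  (* On n, J n, w the equation reads g([n, J n], J w) = g(w, w) g(n, n), which gives the coefficient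
     p. *)
  have := dF n (J n) w; rewrite !wc (lie_brC w) wc oppr0 linear0 !dot0l.
  rewrite gwn gwJn gJ.
  rewrite gJr => dFw; apply: (mulIf gww); rewrite divfK// /p; lra.
have brn y : [lie n, y] =
    (g y (J n) / p * p) *: J w + (g y (J w) / g w w * b) *: J n.
  rewrite {1}(dec y) !lie_brDr !lie_brZr lie_alt wc brnJn brnJw.
  by rewrite !scaler0 add0r addr0 !scalerA.
have brE x y : [lie x, y] =
    (g n x / p) *: [lie n, y] - (g n y / p) *: [lie n, x].
  have [[x' gx xE] [y' gy yE]] := (ndec x, ndec y).
  rewrite {1 3}xE {1 2}yE !(lie_brDl, lie_brDr, lie_brZl, lie_brZr) lie_alt.
  rewrite !scaler0 (ab0 x')//.
  by rewrite (lie_brC x' n) !addr0 add0r scalerN addrC.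
have [phi bphi phic] := coord_row_bij eb.
have phiE x y : phi [lie x, y] = row4
     0 (b * (phi x 0 0 * phi y 0 3 - phi x 0 3 * phi y 0 0))
     0 (p * (phi x 0 0 * phi y 0 1 - phi x 0 1 * phi y 0 0)).
  have phi0 z : phi z 0 0 = g n z / p by rewrite phic eE dotC.
  have phi1 z : phi z 0 1 = g z (J n) / p by rewrite phic eE /= gJ.
  have phi2 z : phi z 0 2 = g z w / g w w by rewrite phic eE.
  have phi3 z : phi z 0 3 = g z (J w) / g w w by rewrite phic eE /= gJ.
  apply: row4P; rewrite ?phi0 ?phi1 ?phi2 ?phi3 !mxE /= ?phi0 ?phi1 ?phi2 ?phi3.
  - by rewrite gbr mul0r.
  - rewrite brE !brn dotDl dotNl !dotZl !dotDl !dotZl !gJ (dotC g w n) gnw -/p.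
    by field; rewrite ?pn0 ?gww.
  - by rewrite dotC gwbr mul0r.
  - rewrite brE !brn dotDl dotNl !dotZl !dotDl !dotZl !gJ gnw -/p.
    by field; rewrite ?pn0 ?gww.
apply: (@lie_isomorphic_row4 R L phi b p) => //.
(* If b = 0, the bracket is J w times a multiple of the area form of the plane of n and J n. That
   form is J-invariant, so the terms of the Nijenhuis tensor cancel in pairs. *)
- apply/eqP => b0; apply: nonint => x y.
  have brE0 z t : [lie z, t] =
      (g n z * g t (J n) / p - g n t * g z (J n) / p) *: J w.
    rewrite brE !brn b0 !mulr0 !scale0r !addr0 !scalerA -scalerBl.
    congr (_ *: _).
    by field; rewrite ?pn0 ?gww.
  have JZ c z : J (c *: z) = c *: J z by exact: linearZ.
  have gJn z : g (J z) (J n) = g n z by rewrite gJ dotC.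
  have gnJ z : g n (J z) = - g z (J n) by rewrite dotC gJr.
  rewrite /nijenhuis -/J !brE0 !gJn !gnJ !JZ JJ !scalerN !opprK.
  rewrite -[_ + _ *: w + _ *: w]addrA -scalerDl.
  rewrite [X in X *: w](_ : _ = 0); last by ring.
  rewrite scale0r addr0 -scalerBl.
  by rewrite [X in X *: J w](_ : _ = 0) ?scale0r//; ring.
- exact: dot_gt0.
Qed.

Theorem theorem32 (R : realType) :
  (forall (L : lieAlgebra R) (h : almostHermitian L) (theta : {scalar L})
      (D N : {bilinear L -> L -> L}) (e : 'I_4 -> L),
    \dim {: L} = 4%N ->
    lie_unimodular L ->
    almost_abelian L ->
    ~ integrable_J h ->
    lee_form h theta ->
    levi_civita h D ->
    parallel_form D theta ->
    (exists x, theta x <> 0) ->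
    chern_connection h N ->
    adapted_frame h e ->
    second_chern_einstein h N e ->
    lie_isomorphic L (A36A1 R) \/ lie_isomorphic L (A34A1 R)) /\
  admits_compact_quotients (A36A1 R) /\
  admits_compact_quotients (A34A1 R).
Proof.
split; last first.
  by split; [exact: A36A1_compact_quotients|exact: A34A1_compact_quotients].
move=> L h theta D N e dimL unim ab nonint lee lc par th0 _ _ _.
exact: (parallel_lee_classification dimL unim ab nonint lee lc par th0).
Qed.
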